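(* Let $X$ be a real Banach space, $k\in\mathbb{Z}^+$ and $\alpha>0$. Then the following statements are equivalent. (1) $X$ is $k$-WUR. (2) $\mathcal{C}$ is $k$-equi $w$USCh on $\mathcal{C}^{\alpha}$, where $\mathcal{C}$ is the collection of all proximinal convex subsets of $X$. (3) $\mathcal{M}$ is $k$-equi $w$USCh on $\mathcal{M}^{\alpha}$, where $\mathcal{M}$ is the collection of all proximinal subspaces of $X$. (4) $\mathcal{H}$ is $k$-equi $w$USCh on $\mathcal{H}^{\alpha}$, where $\mathcal{H}$ is the collection of all proximinal hyperplanes of $X$. (5) $\mathcal{F}$ is $k$-equi $w$USCh on $\mathcal{F}^{\alpha}$, where $\mathcal{F}$ is the collection of all $k$-dimensional subspaces of $X$.
   Context: $S_X$ is the unit sphere of $X$; $X^*$ is the dual. All subspaces are assumed closed. For $x_1,\dots,x_{k+1}\in X$ and $f_1,\dots,f_k\in X^*$, $D_k[(x_i)_{i=1}^{k+1};(f_j)_{j=1}^{k}]$ denotes the determinant of the $(k+1)\times(k+1)$ matrix whose first row consists of ones and whose $(j+1,i)$ entry is $f_j(x_i)$. $X$ is $k$-weakly uniformly rotund ($k$-WUR) if for every $\epsilon>0$ and $f_1,\dots,f_k\in S_{X^*}$, $$\delta^k_X(\epsilon,(f_j)_{j=1}^k):=\inf\Big(\{1\}\cup\Big\{1-\tfrac{1}{k+1}\Big\|\sum_{i=1}^{k+1}x_i\Big\| : x_1,\dots,x_{k+1}\in S_X,\ |D_k[(x_i)_{i=1}^{k+1};(f_j)_{j=1}^{k}]|\ge\epsilon\Big\}\Big)>0.$$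 For a non-empty $A\subseteq X$, $x\in X$, $\delta>0$: $d(x,A)=\inf\{\|x-y\|:y\in A\}$ and $P_A(x,\delta)=\{y\in A:\|x-y\|\le d(x,A)+\delta\}$. $A$ is proximinal if for every $x\in X$ there is $y\in A$ with $\|x-y\|=d(x,A)$. A hyperplane of $X$ is a set $\ker(x^* )=\{x\in X:x^*(x)=0\}$ with $x^*\in S_{X^*}$. For a non-empty closed convex $C\subseteq X$ and $\alpha>0$, $C^{\alpha}=\{x\in X:d(x,C)=\alpha\}$. Let $\mathcal{M}$ be a collection of (non-empty) proximinal convex subsets of $X$ and $\alpha>0$. $\mathcal{M}$ is $k$-equi weakly uniformly strongly Chebyshev ($k$-equi $w$USCh) on $\mathcal{M}^{\alpha}$ if for every $\epsilon>0$ and $f_1,\dots,f_k\in S_{X^*}$ there exists $\delta>0$ such that $|D_k[(x_i)_{i=1}^{k+1};(f_j)_{j=1}^{k}]|\le\epsilon$ whenever $M\in\mathcal{M}$, $x\in M^{\alpha}$ and $x_1,\dots,x_{k+1}\in P_M(x,\delta)$. *)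

(* Defs.v *)
From HB Require Import structures.
From mathcomp Require Import all_boot all_order all_algebra.
From mathcomp Require Import all_classical all_reals all_analysis.

Set Implicit Arguments.
Unset Strict Implicit.
Unset Printing Implicit Defensive.

Import Order.TTheory GRing.Theory Num.Theory.
Import numFieldNormedType.Exports.

Local Open Scope classical_set_scope.
Local Open Scope ring_scope.

Section Definitions.
Variables (R : realType) (X : normedModType R).
Implicit Types (A C : set X) (MM : set (set X)).

Definition unit_sphere : set X := [set x | `|x| = 1].

(* The supremum is over the closed unit ball, which is non-empty even when
   X = 0; it is the operator norm when f is continuous (for discontinuous f
   the real-valued [sup] is a default value). *)
Definition dual_norm (f : {linear X -> R^o}) : R :=
  sup [set `|f x| | x in [set x : X | `|x| <= 1]].

Definition dual_unit_sphere : set {linear X -> R^o} :=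
  [set f : {linear X -> R^o} | continuous (f : X -> R^o) /\ dual_norm f = 1].

Definition Dmx (k : nat) (x : 'I_k.+1 -> X) (f : 'I_k -> {linear X -> R^o}) :
    'M[R]_k.+1 :=
  col_mx (const_mx 1 : 'rV[R]_k.+1)
         (\matrix_(j < k, i < k.+1) (f j (x i) : R)).

Definition Dk (k : nat) (x : 'I_k.+1 -> X) (f : 'I_k -> {linear X -> R^o}) : R :=
  \det (Dmx x f).

Definition modulus_WUR (k : nat) (eps : R) (f : 'I_k -> {linear X -> R^o}) : R :=
  inf ([set 1] `|`
       [set 1 - k.+1%:R^-1 * `|\sum_(i < k.+1) x i| | x in
         [set x : 'I_k.+1 -> X |
           (forall i, unit_sphere (x i)) /\ eps <= `|Dk x f|]]).

Definition WUR (k : nat) : Prop :=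
  forall (eps : R) (f : 'I_k -> {linear X -> R^o}),
    0 < eps -> (forall j, dual_unit_sphere (f j)) -> 0 < modulus_WUR eps f.

(* Only meaningful for A non-empty. *)
Definition dist_set (x : X) A : R := inf [set `|x - y| | y in A].

Definition near_proj A (x : X) (delta : R) : set X :=
  [set y | A y /\ `|x - y| <= dist_set x A + delta].

Definition proximinal A : Prop :=
  forall x : X, exists2 y, A y & `|x - y| = dist_set x A.

Definition level_set C (alpha : R) : set X := [set x | dist_set x C = alpha].

Definition closed_subspace A : Prop := submod_closed (mem A) /\ closed A.

Definition hyperplane A : Prop :=
  exists2 f : {linear X -> R^o}, dual_unit_sphere f & A = [set x | f x = 0].

Definition has_dim (k : nat) A : Prop :=
  exists b : 'I_k -> X,
    (forall c : 'I_k -> R, \sum_(j < k) c j *: b j = 0 -> forall j, c j = 0) /\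
    A = [set \sum_(j < k) c j *: b j | c in [set: 'I_k -> R]].

Definition proximinal_convex_sets : set (set X) :=
  [set A | [/\ A !=set0, convex_set A & proximinal A]].

Definition proximinal_subspaces : set (set X) :=
  [set A | closed_subspace A /\ proximinal A].

Definition proximinal_hyperplanes : set (set X) :=
  [set A | hyperplane A /\ proximinal A].

Definition kdim_subspaces (k : nat) : set (set X) :=
  [set A | closed_subspace A /\ has_dim k A].

(* Intended for a collection MM of non-empty proximinal convex sets; the
   finite-dimensional subspaces are such sets by compactness. *)
Definition equi_wUSCh (k : nat) MM (alpha : R) : Prop :=
  forall (eps : R) (f : 'I_k -> {linear X -> R^o}),
    0 < eps -> (forall j, dual_unit_sphere (f j)) ->
    exists2 delta : R, 0 < delta &
      forall (A : set X) (x : X) (y : 'I_k.+1 -> X),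
        MM A -> level_set A alpha x -> (forall i, near_proj A x delta (y i)) ->
        `|Dk y f| <= eps.

End Definitions.

Arguments WUR {R} X k.
Arguments proximinal_convex_sets {R} X.
Arguments proximinal_subspaces {R} X.
Arguments proximinal_hyperplanes {R} X.
Arguments kdim_subspaces {R} X k.

(* Main.v *)
(* (1) implies the property for every family of convex sets: if the y_i are
   almost best approximations of x in A, the normalised vectors
   (x - y_i) / |x - y_i| have an average of norm close to 1, since the average of
   the y_i lies in A.

   Conversely, let the x_i be unit vectors whose sum a almost has maximal norm, and
   let g be a norm-one functional with g(a) = |a|.  Then g(x_i) is close to 1, and
   u_i := x_i / g(x_i) lies on the hyperplane g = 1.  The differences u_0 - u_i span
   a k-dimensional subspace A of ker g (unless the determinant vanishes), and
   d(u_0, A) >= 1 while |u_0 - (u_0 - u_i)| = 1 / g(x_i) is close to 1.  Hence, after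
   rescaling, the u_0 - u_i are almost best approximations of u_0 both in A, which
   gives (5) => (1), and in ker g, which is proximinal because g attains its norm,
   which gives (4) => (1). *)
From HB Require Import structures.
Require Import Defs.
From mathcomp Require Import all_boot all_order all_algebra.
From mathcomp Require Import all_classical all_reals all_analysis.
From mathcomp Require Import perm ring lra.
Import Order.TTheory GRing.Theory Num.Theory.
Import numFieldNormedType.Exports.
Local Open Scope ring_scope.

Set Implicit Arguments.
Unset Strict Implicit.
Unset Printing Implicit Defensive.

(** * Sublinear functionals and the existence of norming functionals *)

Section HahnBanach.
Variables (R : realType) (X : normedModType R).
Implicit Types (p q : X -> R) (x y : X).
Local Open Scope classical_set_scope.

Lemma le_inf_add (A B : set R) (c : R) : A !=set0 -> B !=set0 ->
  (forall a b, A a -> B b -> c <= a + b) -> c <= inf A + inf B.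
Proof.
move=> A0 B0 h; rewrite -lerBlDr; apply: lb_le_inf => // a Aa.
by rewrite lerBlDr addrC -lerBlDr; apply: lb_le_inf => // b Bb;
  rewrite lerBlDr addrC; apply: h.
Qed.

(** Homogeneity is asked only as an inequality for [t > 0], the form that passes to infima; equality
    is recovered by using [t^-1]. The bound by the norm keeps such infima finite. *)
Definition sublinear p : Prop :=
  [/\ forall x y, p (x + y) <= p x + p y,
      forall t x, 0 < t -> p (t *: x) <= t * p x
    & forall x, p x <= `|x|].

Lemma sublinear_norm : sublinear (fun x => `|x|).
Proof. by split=> // [x y|t x t0]; rewrite ?ler_normD// normrZ gtr0_norm. Qed.

Lemma sublinear0 p : sublinear p -> p 0 = 0.
Proof.
move=> [pD _ pn]; apply/le_anti; have := pn 0; rewrite normr0 => -> /=.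
by have := pD 0 0; rewrite addr0 -subr_ge0 addrK.
Qed.

Lemma sublinear_ge_oppN p x : sublinear p -> - p (- x) <= p x.
Proof.
by move=> sp; case: (sp) => pD _ _; have := pD x (- x); rewrite subrr sublinear0// -lerBlDr sub0r.
Qed.

Lemma sublinearZ p t x : sublinear p -> 0 <= t -> p (t *: x) = t * p x.
Proof.
move=> sp; rewrite le_eqVlt => /predU1P[<-|t0].
  by rewrite scale0r mul0r sublinear0.
case: (sp) => _ pZ _; apply/le_anti; rewrite pZ//=.
rewrite -ler_pdivlMl//; have := pZ t^-1 (t *: x).
by rewrite scalerA mulVf ?gt_eqF// scale1r invr_gt0; apply.
Qed.

(* The candidate is [q x = inf_(t >= 0) (p (x + t y) - t p y)]. *)
Lemma sublinear_descent p y : sublinear p ->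
  exists q, [/\ sublinear q, forall x, q x <= p x
    & forall x, q x <= p (x + y) - p y].
Proof.
move=> sp; case: (sp) => pD _ pn.
pose S x := [set p (x + t *: y) - t * p y | t in [set t : R | 0 <= t]].
have S0 x : S x !=set0 by exists (p (x + 0 *: y) - 0 * p y), 0 => /=.
have lbS x : has_lbound (S x).
  exists (- p (- x)) => _ [t /= t0 <-].
  rewrite lerBrDr -sublinearZ// addrC lerBlDr addrC.
  by rewrite -{1}[t *: y](addKr x).
have infS x t : 0 <= t -> inf (S x) <= p (x + t *: y) - t * p y.
  by move=> t0; apply: ge_inf => //; exists t.
exists (fun x => inf (S x)).
(* [t = 0] gives [q <= p], and [t = 1] gives the bound along [y]. *)
have le1 x : inf (S x) <= p x.
  by have := infS x 0 (lexx _); rewrite scale0r mul0r addr0 subr0.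
split=> [|//|x]; last by have := infS x 1 ler01; rewrite scale1r mul1r.
split=> [x x'|t x t0|x]; last exact: le_trans (le1 x) (pn x).
- apply: le_inf_add => // _ _ [t /= t0 <-] [t' /= t'0 <-].
  apply: le_trans (infS _ (t + t') (addr_ge0 t0 t'0)) _.
  rewrite scalerDl addrACA [(t + t') * _]mulrDl.
  by have := pD (x + t *: y) (x' + t' *: y); lra.
- rewrite mulrC -ler_pdivrMr//; apply: lb_le_inf => // _ [s /= s0 <-].
  rewrite ler_pdivrMr//; apply: le_trans (infS _ (t * s) _) _.
    by rewrite mulr_ge0 // ltW.
  rewrite -scalerA -scalerDr sublinearZ ?(ltW t0)//.
  by rewrite -mulrA -mulrBr mulrC.
Qed.

(** The pointwise infimum works. It is finite because [p x >= - p (- x) >= - |x|], and subadditive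
    because, of two members of a chain, the smaller one can be used at both points. *)
Lemma sublinear_chain_inf (A : set (X -> R)) : A !=set0 ->
  A `<=` sublinear -> total_on A (fun p q => forall x, p x <= q x) ->
  exists2 q, sublinear q & forall p, A p -> forall x, q x <= p x.
Proof.
move=> [p0 Ap0] As tA; pose S x := [set p x | p in A].
have S0 x : S x !=set0 by exists (p0 x), p0.
have infS p x : A p -> inf (S x) <= p x.
  move=> Ap; apply: ge_inf; last by exists p.
  exists (- `|x|) => _ [q Aq <-]; have [_ _ qn] := As _ Aq.
  by rewrite (le_trans _ (sublinear_ge_oppN _ (As _ Aq)))// lerN2 -normrN.
exists (fun x => inf (S x)); last by move=> p Ap x; exact: infS.
split=> [x y|t x t0|x].
- apply: le_inf_add => // _ _ [p Ap <-] [q Aq <-].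
  case: (tA _ _ Ap Aq) => pq.
    have [pD _ _] := As _ Ap.
    by rewrite (le_trans (infS _ _ Ap))// (le_trans (pD _ _))// lerD2l.
  have [qD _ _] := As _ Aq.
  by rewrite (le_trans (infS _ _ Aq))// (le_trans (qD _ _))// lerD2r.
- rewrite mulrC -ler_pdivrMr//; apply: lb_le_inf => // _ [p Ap <-].
  have [_ pZ _] := As _ Ap.
  by rewrite ler_pdivrMr// mulrC (le_trans (infS _ _ Ap))// pZ.
- by have [_ _ pn] := As _ Ap0; rewrite (le_trans (infS _ _ Ap0)).
Qed.

Lemma sublinear_minimal p0 : sublinear p0 ->
  exists p, [/\ sublinear p, forall x, p x <= p0 x
    & forall q, sublinear q -> (forall x, q x <= p x) -> q = p].
Proof.
move=> sp0.
pose T := {p : X -> R | sublinear p /\ forall x, p x <= p0 x}.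
(* The order is reversed, so that a maximal element from Zorn's lemma is a minimal functional. *)
pose le (a b : T) : bool := `[< forall x, sval b x <= sval a x >].
have [||||[p [sp pp0]] pmin] := @Zorn T le.
- by move=> a; apply/asboolP.
- by move=> a b c /asboolP ab /asboolP bc; apply/asboolP => x; apply: le_trans (bc x) (ab x).
- move=> [p sp] [q sq] /asboolP /= pq /asboolP /= qp; apply: eq_exist.
  by apply/funext => x; apply/le_anti; rewrite pq qp.
- move=> A tA.
  have [[a Aa]|A0] := pselect (A !=set0); last first.
    by exists (exist _ p0 (conj sp0 (fun=> lexx _))) => a Aa; case: A0; exists a.
  have [|||q sq qA] := @sublinear_chain_inf (sval @` A).
  - by exists (sval a), a.
  - by move=> _ [[b [sb bb]] _ <-].
  - move=> _ _ [b Ab <-] [c Ac <-].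
    by case: (tA _ _ Ab Ac) => /asboolP h; [right|left].
  have qp0 x : q x <= p0 x.
    by apply: le_trans (proj2 (svalP a) x); apply: qA; exists a.
  by exists (exist _ q (conj sq qp0)) => b Ab; apply/asboolP => x /=; apply: qA; exists b.
- exists p; split=> // q sq qp.
  have qp0 x : q x <= p0 x by apply: le_trans (qp x) (pp0 x).
  by apply: (congr1 sval (pmin (exist _ q (conj sq qp0)) _)); apply/asboolP.
Qed.

(* A minimal sublinear functional is linear: descending along [y] leaves it
   unchanged, which makes it superadditive. *)
Lemma norming_functional a :
  exists2 g : {linear X -> R^o}, (forall x, g x <= `|x|) & g a = `|a|.
Proof.
(* Descending from the norm along [a] gives [q0 (- a) <= - |a|]. Everything below [q0] inherits
   this, which in the end forces [g a = |a|]. *)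
have [q0 [sq0 _ q0a]] := sublinear_descent a sublinear_norm.
have [p [sp pq0 pmin]] := sublinear_minimal sq0.
case: (sp) => pD _ pn.
have {}pD x y : p (x + y) = p x + p y.
  apply/le_anti; rewrite pD /= -lerBrDr.
  have [q [sq qp qy]] := sublinear_descent y sp.
  by have := qy x; rewrite (pmin q sq qp).
have pN x : p (- x) = - p x.
  by apply/eqP; rewrite -addr_eq0 -pD addNr sublinear0.
have plin : linear (p : X -> R^o).
  move=> t x y; rewrite pD; congr (_ + _).
  have [t0|t0] := leP 0 t; first by rewrite sublinearZ.
  rewrite -[t in LHS]opprK scaleNr pN sublinearZ ?oppr_ge0 ?ltW//.
  by rewrite mulNr opprK.
pose g : {linear X -> R^o} := HB.pack (p : X -> R^o)
  (GRing.isLinear.Build R X R^o *:%R (p : X -> R^o) plin).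
exists g => //=; apply/le_anti; rewrite pn /=.
have := le_trans (pq0 (- a)) (q0a (- a)).
by rewrite pN addNr normr0 sub0r lerN2.
Qed.

End HahnBanach.

(** * Perturbation and affine change of the determinants [Dk] *)

Section Determinants.
Variable R : realType.

(** Telescoping: factors are exchanged one at a time, each exchange costing at most [e] since the
    other factors are bounded by 1. *)
Lemma prod_dist_le (I : Type) (s : seq I) (a b : I -> R) (e : R) :
  (forall i, `|a i| <= 1) -> (forall i, `|b i| <= 1) ->
  (forall i, `|a i - b i| <= e) ->
  `|\prod_(i <- s) a i - \prod_(i <- s) b i| <= (size s)%:R * e.
Proof.
move=> a1 b1 ab; elim: s => [|i s IHs]; first by rewrite !big_nil subrr normr0 mul0r.
have pb : `|\prod_(j <- s) b j| <= 1.
  by rewrite normr_prod; apply: prodr_ile1 => j _; rewrite normr_ge0 b1.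
rewrite !big_cons.
have -> : a i * \prod_(j <- s) a j - b i * \prod_(j <- s) b j =
  a i * (\prod_(j <- s) a j - \prod_(j <- s) b j) + (a i - b i) * \prod_(j <- s) b j.
  by ring.
rewrite (le_trans (ler_normD _ _))// !normrM /= -natr1 mulrDl mul1r lerD//.
  by rewrite -[leRHS]mul1r ler_pM.
by rewrite -[leRHS]mulr1 ler_pM.
Qed.

(** The Leibniz formula has [n!] terms, each a signed product of [n] entries. *)
Lemma det_dist_le n (A B : 'M[R]_n) (e : R) :
  (forall i j, `|A i j| <= 1) -> (forall i j, `|B i j| <= 1) ->
  (forall i j, `|A i j - B i j| <= e) ->
  `|\det A - \det B| <= (n`! * n)%:R * e.
Proof.
move=> A1 B1 AB; rewrite /determinant -sumrB (le_trans (ler_norm_sum _ _ _))//.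
have -> : (n`! * n)%:R * e = \sum_(s : 'S_n) n%:R * e.
  by rewrite sumr_const card_Sn natrM -mulrA mulr_natl.
apply: ler_sum => s _; rewrite -mulrBr normrMsign.
have := @prod_dist_le _ (index_enum 'I_n) (fun i => A i (s i)) (fun i => B i (s i)) e.
by rewrite -sum1_size sum1_card card_ord; apply.
Qed.

Variable X : normedModType R.
Implicit Types (k : nat).

Lemma dual_sphere_le (f : {linear X -> R^o}) x :
  dual_unit_sphere f -> `|f x| <= `|x|.
Proof.
move=> [_ f1].
(* Without a genuine supremum, [sup] takes its default value 0, contradicting [dual_norm f = 1]. *)
have [hs|/sup_out] := pselect (has_sup [set `|f x| | x in [set x : X | `|x| <= 1]]%classic); last first.
  by move=> h; move: f1; rewrite /dual_norm h => /eqP; rewrite eq_sym oner_eq0.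
have [->|x0] := eqVneq x 0; first by rewrite linear0 !normr0.
have nx : 0 < `|x| by rewrite normr_gt0.
have : `|f (`|x|^-1 *: x)| <= 1.
  rewrite -f1; apply: sup_upper_bound => //; exists (`|x|^-1 *: x) => //=.
  by rewrite normrZ gtr0_norm ?invr_gt0// mulVf// gt_eqF.
by rewrite linearZ /= normrZ gtr0_norm ?invr_gt0// ler_pdivrMl// mulr1.
Qed.

Lemma row_cases k (i : 'I_k.+1) :
  i = lshift k (ord0 : 'I_1) \/ exists i' : 'I_k, i = rshift 1 i'.
Proof.
case: (@splitP 1 k i) => i' ii'; [left|right; exists i']; apply: val_inj => //.
by rewrite /= ii' ord1.
Qed.

Lemma Dmx_top k (x : 'I_k.+1 -> X) f (j : 'I_k.+1) : Dmx x f (lshift k (ord0 : 'I_1)) j = 1.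
Proof. by rewrite (@col_mxEu R 1 k k.+1) mxE. Qed.

Lemma Dmx_bot k (x : 'I_k.+1 -> X) f (i : 'I_k) (j : 'I_k.+1) : Dmx x f (rshift 1 i) j = f i (x j).
Proof. by rewrite (@col_mxEd R 1 k k.+1) mxE. Qed.

(** Since the top row consists of ones, the affine map acts on the matrix as left multiplication by
    a block lower triangular matrix with diagonal blocks 1 and [c] times the identity. *)
Lemma Dk_affine k (a : X) (c : R) (x : 'I_k.+1 -> X) f :
  Dk (fun i => a + c *: x i) f = c ^+ k * Dk x f.
Proof.
rewrite /Dk.
pose L : 'M[R]_(1 + k) := block_mx 1%:M 0 (\col_i f i a) c%:M.
have -> : Dmx (fun i => a + c *: x i) f = L *m Dmx x f.
  rewrite /Dmx mul_block_col mul1mx mul0mx addr0.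
  apply: (congr1 (@col_mx R 1 k k.+1 (const_mx 1))).
  rewrite mul_scalar_mx; apply/matrixP => i j.
  by rewrite !mxE big_ord1 !mxE mulr1 linearD linearZ.
have detL : \det L = c ^+ k by rewrite det_lblock det1 det_scalar mul1r.
by rewrite -detL; exact: (det_mulmx (L : 'M[R]_k.+1)).
Qed.

Lemma Dk_dist_le k (x y : 'I_k.+1 -> X) f (e : R) :
  0 <= e -> (forall j, dual_unit_sphere (f j)) ->
  (forall i, `|x i| <= 1) -> (forall i, `|y i| <= 1) ->
  (forall i, `|x i - y i| <= e) ->
  `|Dk x f| <= `|Dk y f| + (k.+1`! * k.+1)%:R * e.
Proof.
move=> e0 fS x1 y1 xy; rewrite -lerBlDl (le_trans (lerB_dist _ _))//.
have D1 (z : 'I_k.+1 -> X) i j : (forall i, `|z i| <= 1) -> `|Dmx z f i j| <= 1.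
  case: (row_cases i) => [->|[i' ->]] z1; first by rewrite Dmx_top normr1.
  by rewrite Dmx_bot (le_trans (dual_sphere_le _ _)).
apply: det_dist_le => i j; [exact: D1|exact: D1|].
case: (row_cases i) => [->|[i' ->]]; first by rewrite !Dmx_top subrr normr0.
by rewrite !Dmx_bot -linearB (le_trans (dual_sphere_le _ _)).
Qed.

End Determinants.

(** * Distances to sets and averages in convex sets *)

Section Rotundity.
Variables (R : realType) (X : normedModType R).
Implicit Types (A : set X) (x y : X) (k : nat).
Local Open Scope classical_set_scope.

Lemma dist_set_le A x y : A y -> dist_set x A <= `|x - y|.
Proof.
by move=> Ay; apply: ge_inf; [exists 0 => _ [z _ <-]|exists y].
Qed.

Lemma le_dist_set A x (c : R) : A !=set0 -> (forall y, A y -> c <= `|x - y|) ->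
  c <= dist_set x A.
Proof.
by move=> [y Ay] h; apply: lb_le_inf; [exists `|x - y|, y|move=> _ [z Az <-]; exact: h].
Qed.

Lemma dist_setZ A x (c : R) : 0 < c -> A !=set0 ->
  (forall t y, A y -> A (t *: y)) -> dist_set (c *: x) A = c * dist_set x A.
Proof.
move=> c0 A0 AZ.
have le t z : 0 < t -> dist_set (t *: z) A <= t * dist_set z A.
  move=> t0; rewrite -ler_pdivrMl//; apply: le_dist_set => // y Ay.
  rewrite ler_pdivrMl// (le_trans (dist_set_le _ (AZ t _ Ay)))//.
  by rewrite -scalerBr normrZ gtr0_norm.
apply/le_anti; rewrite le//= -ler_pdivlMl//.
have := le c^-1 (c *: x); rewrite scalerA mulVf ?gt_eqF// scale1r; apply.
by rewrite invr_gt0.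
Qed.

Lemma convex_set_average A n (y : 'I_n.+1 -> X) : convex_set A ->
  (forall i, A (y i)) -> A (n.+1%:R^-1 *: \sum_i y i).
Proof.
move=> cA; elim: n y => [|n IHn] y Ay.
  by rewrite big_ord1 invr1 scale1r.
rewrite big_ord_recr /=.
have n1 : (n.+1%:R : R) != 0 by rewrite pnatr_eq0.
have n2 : (n.+2%:R : R) != 0 by rewrite pnatr_eq0.
have l0 : 0 <= n.+1%:R / n.+2%:R :> R by rewrite divr_ge0.
have l1 : n.+1%:R / n.+2%:R <= 1 :> R by rewrite ler_pdivrMr// mul1r ler_nat.
have /mem_set a := IHn (fun i => y (widen_ord (leqnSn n.+1) i)) (fun i => Ay _).
have : A ((n.+1%:R / n.+2%:R) *: (n.+1%:R^-1 *: \sum_i y (widen_ord (leqnSn n.+1) i))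
          + (1 - n.+1%:R / n.+2%:R) *: y ord_max).
  by have := cA _ _ (Itv01 l0 l1) a (mem_set (Ay ord_max)); rewrite inE.
rewrite scalerA mulrAC mulfV// mul1r -[X in X - _](mulfV n2) -mulrBl.
by rewrite -natrB// subSnn mul1r -scalerDr.
Qed.

Lemma WUR_modulus_le k (eps : R) (f : 'I_k -> {linear X -> R^o}) (u : 'I_k.+1 -> X) :
  (forall i, `|u i| = 1) -> eps <= `|Dk u f| ->
  modulus_WUR eps f <= 1 - k.+1%:R^-1 * `|\sum_(i < k.+1) u i|.
Proof.
move=> u1 Du; apply: ge_inf; last by right; exists u.
exists 0 => _ [->//|[v [v1 _] <-]].
rewrite subr_ge0 ler_pdivrMl// mulr1 (le_trans (ler_norm_sum _ _ _))//.
by under eq_bigr do rewrite v1; rewrite sumr_const card_ord.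
Qed.

(** * From weak uniform rotundity to almost best approximations *)

Lemma WUR_equi k (MM : set (set X)) (alpha : R) : 0 < alpha ->
  (forall A, MM A -> convex_set A) -> WUR X k -> equi_wUSCh k MM alpha.
Proof.
move=> al0 cMM wX eps f eps0 fS.
pose C : R := (k.+1`! * k.+1)%:R.
have C0 : 0 < C by rewrite ltr0n muln_gt0 fact_gt0.
(* [b] will bound [(alpha + d) ^+ k], and [eta] is chosen so that [b * (2 * eta) = eps]. *)
pose b := (alpha *+ 2) ^+ k.
have b0 : 0 < b by rewrite exprn_gt0// mulrn_wgt0.
pose eta := eps / b / 2.
have eta0 : 0 < eta by rewrite !divr_gt0.
have m0 := wX eta f eta0 fS; set m := modulus_WUR _ _ in m0.
(* The three bounds serve, in order, to get [alpha + d <= 2 * alpha], to contradict the modulus [m],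
   and to keep the determinant error [C * (d / alpha)] below [eta]. *)
pose d := Num.min alpha (Num.min (alpha * m / 2) (alpha * (eta / C))).
have d0 : 0 < d by rewrite !lt_min al0 !mulr_gt0 ?invr_gt0 ?eps0.
have [d1 d2 d3] : [/\ d <= alpha, d <= alpha * m / 2 & d <= alpha * (eta / C)].
  by rewrite /d; split; rewrite !ge_min lexx ?orbT.
clearbody d; exists d => // A x y MA xA yA.
have Ay i : A (y i) by case: (yA i).
pose z i := x - y i.
have z1 i : alpha <= `|z i| by rewrite -[leLHS]xA; apply: dist_set_le.
have z2 i : `|z i| <= alpha + d by rewrite -{1}[alpha]xA; case: (yA i).
have zgt0 i : 0 < `|z i| by apply: lt_le_trans (z1 i).
pose u i := `|z i|^-1 *: z i.
have uz i : z i = `|z i| *: u i by rewrite scalerA mulfV ?gt_eqF// scale1r.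
have u1 i : `|u i| = 1 by rewrite normrZ gtr0_norm ?invr_gt0// mulVf ?gt_eqF.
have n0 : (k.+1%:R : R) != 0 by rewrite pnatr_eq0.
have avgz : alpha <= k.+1%:R^-1 * `|\sum_(i < k.+1) z i|.
  rewrite -[k.+1%:R^-1]gtr0_norm ?invr_gt0// -normrZ.
  have -> : k.+1%:R^-1 *: (\sum_(i < k.+1) z i) = x - k.+1%:R^-1 *: \sum_(i < k.+1) y i.
    rewrite sumrB scalerBr sumr_const card_ord -[x *+ _]scaler_nat.
    by rewrite scalerA mulVf// scale1r.
  by rewrite -[leLHS]xA dist_set_le//; apply: convex_set_average => //; apply: cMM.
have avgu : alpha - d <= alpha * (k.+1%:R^-1 * `|\sum_(i < k.+1) u i|).
  have : `|\sum_(i < k.+1) z i| <= alpha * `|\sum_(i < k.+1) u i| + k.+1%:R * d.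
    have -> : \sum_(i < k.+1) z i = alpha *: (\sum_(i < k.+1) u i) + \sum_(i < k.+1) (`|z i| - alpha) *: u i.
      rewrite scaler_sumr -big_split /=; apply: eq_bigr => i _.
      by rewrite -scalerDl addrC subrK -uz.
    rewrite (le_trans (ler_normD _ _))// normrZ gtr0_norm// lerD2l.
    rewrite (le_trans (ler_norm_sum _ _ _))//.
    have -> : k.+1%:R * d = \sum_(i < k.+1) d by rewrite sumr_const card_ord mulr_natl.
    apply: ler_sum => i _; rewrite normrZ u1 mulr1 ger0_norm ?subr_ge0//.
    by rewrite lerBlDl.
  move=> h; have : k.+1%:R^-1 * `|\sum_(i < k.+1) z i| <= alpha * (k.+1%:R^-1 * `|\sum_(i < k.+1) u i|) + d.
    by rewrite ler_pdivrMl// mulrDr [_ * (alpha * _)]mulrCA mulVKf.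
  by move=> h'; rewrite lerBlDr; apply: le_trans avgz h'.
(* Otherwise the average of the [u i] has norm at most [1 - m], so [alpha * m <= d], against
   [d <= alpha * m / 2]. *)
have Du : `|Dk u f| < eta.
  rewrite ltNge; apply/negP => /(WUR_modulus_le u1).
  move: avgu; rewrite -/m; set t := _ * `|_| => avgu mu.
  have := ler_wpM2l (ltW al0) mu; rewrite mulrBr mulr1.
  have : 0 < alpha * m by rewrite mulr_gt0.
  by clearbody m t; lra.
(* Dividing all [z i] by the common factor [c] puts them in the unit ball, within [d / alpha] of the
   [u i]; a common factor is what [Dk_affine] can undo. *)
pose c := alpha + d.
have c0 : 0 < c by rewrite addr_gt0.
have Dz : `|Dk (fun i => c^-1 *: z i) f| <= eta *+ 2.
  have e0 : 0 <= d / alpha by rewrite divr_ge0 ?ltW.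
  have zc i : `|c^-1 *: z i| = `|z i| / c.
    by rewrite normrZ gtr0_norm ?invr_gt0// mulrC.
  rewrite (le_trans (Dk_dist_le (y := u) e0 fS _ _ _))//.
  - by move=> i; rewrite zc ler_pdivrMr// mul1r.
  - by move=> i; rewrite u1.
  - move=> i; rewrite {1}uz scalerA -[X in _ - X]scale1r -scalerBl normrZ u1 mulr1.
    rewrite mulrC distrC ger0_norm ?subr_ge0 ?ler_pdivrMr ?mul1r//.
    apply: (@le_trans _ _ (d / c)).
      rewrite -[X in X - _](mulfV (lt0r_neq0 c0)) -mulrBl ler_pM2r ?invr_gt0//.
      by rewrite /c; have := z1 i; lra.
    by rewrite ler_pM2l// lef_pV2 ?posrE// /c lerDl ltW.
  - rewrite mulr2n lerD ?(ltW Du)// -/C mulrC -ler_pdivlMr// mulrC.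
    by rewrite ler_pdivrMl.
have yE : y = (fun i => x + (- c) *: (c^-1 *: z i)).
  apply/funext => i.
  by rewrite scalerA mulNr mulfV ?gt_eqF// scaleN1r opprB addrC subrK.
rewrite yE Dk_affine normrM normrX normrN (gtr0_norm c0).
have -> : eps = b * (eta *+ 2) by rewrite /eta; field; exact: lt0r_neq0.
apply: ler_pM => //; first by rewrite exprn_ge0// ltW.
apply: lerXn2r; rewrite ?nnegrE ?mulrn_wge0 ?(ltW c0) ?(ltW al0)//.
by rewrite mulr2n /c lerD2l.
Qed.

(** * Norming functionals and the converse implication *)

Lemma norming_le (g : {linear X -> R^o}) :
  (forall x, g x <= `|x|) -> forall x, `|g x| <= `|x|.
Proof.
by move=> gn x; rewrite ler_norml gn andbT lerNl -linearN (le_trans (gn _))// normrN.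
Qed.

Lemma norming_continuous (g : {linear X -> R^o}) :
  (forall x, g x <= `|x|) -> continuous (g : X -> R^o).
Proof.
move=> gn; apply: bounded_linear_continuous; apply/linear_boundedP.
near=> r; move=> x /=.
by rewrite (le_trans (norming_le gn x))// ler_peMl.
Unshelve. all: by end_near. Qed.

Lemma norming_dual_sphere (g : {linear X -> R^o}) e :
  (forall x, g x <= `|x|) -> `|e| = 1 -> g e = 1 -> dual_unit_sphere g.
Proof.
move=> gn e1 ge; split; first exact: norming_continuous.
have ub : ubound [set `|g x| | x in [set x : X | `|x| <= 1]] 1.
  by move=> _ [x /= x1 <-]; rewrite (le_trans (norming_le gn x)).
apply/le_anti/andP; split.
  by apply: ge_sup => //; exists `|g e|, e => //=; rewrite e1.
apply: ub_le_sup; first by exists 1.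
by exists e => /=; rewrite ?e1 ?ge ?normr1.
Qed.

(** Common core of (4) => (1) and (5) => (1): the family need only supply, for each nondegenerate
    configuration on [g = 1], a set within the kernel of [g] that is stable under scaling and
    contains the differences. *)
Lemma equi_WUR k (MM : set (set X)) (alpha : R) : 0 < alpha ->
  (forall (g : {linear X -> R^o}) e (u : 'I_k.+1 -> X) f,
     (forall x, g x <= `|x|) -> `|e| = 1 -> g e = 1 ->
     (forall i, g (u i) = 1) -> (forall j, dual_unit_sphere (f j)) ->
     Dk u f != 0 ->
     exists A, [/\ MM A, forall i, A (u ord0 - u i), forall y, A y -> g y = 0
       & forall t y, A y -> A (t *: y)]) ->
  equi_wUSCh k MM alpha -> WUR X k.
Proof.
move=> al0 hMM equi eps f eps0 fS.
pose C : R := (k.+1`! * k.+1)%:R.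
have C0 : 0 < C by rewrite ltr0n muln_gt0 fact_gt0.
(* A lower bound for [r ^+ k], where [r = alpha / d] is the later rescaling factor and
   [d <= s^-1 <= 2]. *)
pose b := (alpha / 2) ^+ k.
have b0 : 0 < b by rewrite exprn_gt0// divr_gt0.
have e'0 : 0 < b * (eps / 4) by rewrite mulr_gt0// divr_gt0.
have [d0 d0gt hd0] := equi _ f e'0 fS.
(* The three bounds give, with [s = 1 - t], in order: [s >= 1/2], then [alpha / s <= alpha + d0],
   and a determinant error [C * t <= eps / 4]. *)
pose t := Num.min (2^-1) (Num.min (d0 / (2 * alpha)) (eps / (4 * C))).
have t0 : 0 < t.
  by rewrite !lt_min; apply/and3P; split; rewrite ?divr_gt0 ?mulr_gt0 ?invr_gt0.
have [t1 t2 t3] : [/\ t <= 2^-1, t <= d0 / (2 * alpha) & t <= eps / (4 * C)].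
  by rewrite /t; split; rewrite !ge_min lexx ?orbT.
clearbody t.
have {}t2 : alpha * t <= d0 / 2.
  move: t2; rewrite ler_pdivlMr ?mulr_gt0// => t2.
  by rewrite ler_pdivlMr// mulrC mulrA mulrC.
have {}t3 : C * t <= eps / 4.
  move: t3; rewrite ler_pdivlMr ?mulr_gt0// => t3.
  by rewrite ler_pdivlMr// mulrC mulrA mulrC.
pose N : R := k.+1%:R.
have N0 : 0 < N by rewrite ltr0n.
have N1 : 1 <= N by rewrite ler1n.
suff : t / N <= modulus_WUR eps f.
  by apply: lt_le_trans; rewrite divr_gt0.
apply: lb_le_inf; first by exists 1; left.
move=> _ [->|[x [x1 Dx] <-]].
  by rewrite ler_pdivrMr// mul1r; lra.
rewrite leNgt; apply/negP => xlt.
pose a := \sum_(i < k.+1) x i.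
have aN : N - t < `|a|.
  move: xlt; rewrite -/N -/a ltrBlDr -ltrBlDl ltr_pdivlMl// mulrBr mulr1.
  by rewrite mulrCA mulfV ?gt_eqF// mulr1.
have a0 : 0 < `|a| by apply: lt_trans aN; lra.
have [g gn ga] := norming_functional a.
pose e := `|a|^-1 *: a.
have e1 : `|e| = 1 by rewrite normrZ gtr0_norm ?invr_gt0// mulVf// gt_eqF.
have ge : g e = 1 by rewrite linearZ /= ga; apply: mulVf; rewrite gt_eqF.
pose s := 1 - t.
have s0 : 2^-1 <= s by rewrite /s; lra.
have sgt0 : 0 < s by apply: lt_le_trans s0.
have gx1 i : g (x i) <= 1 by rewrite -(x1 i).
(* The [k.+1] values [g (x j)] sum to more than [k.+1 - t], and the other [k] are at most 1. *)
have gxs i : s <= g (x i).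
  move: aN; rewrite -ga /a linear_sum (bigD1 i)//= => aN.
  have : \sum_(j < k.+1 | j != i) g (x j) <= \sum_(j < k.+1 | j != i) 1.
    by apply: ler_sum.
  rewrite sumr_const (_ : #|_| = k); last first.
    by rewrite (eq_card (B := predC1 i))// cardC1 card_ord.
  by move: aN; rewrite /N /s -natr1; lra.
have gx0 i : 0 < g (x i) by apply: lt_le_trans (gxs i).
pose u i := (g (x i))^-1 *: x i.
have gu i : g (u i) = 1 by rewrite linearZ /=; apply: mulVf; rewrite gt_eqF.
have un i : `|u i| <= s^-1.
  by rewrite normrZ x1 mulr1 gtr0_norm ?invr_gt0// lef_pV2 ?posrE.
(* [x i] is compared with [s *: u i], which stays in the unit ball: as [s <= s / g (x i) <= 1], they
   differ by at most [t]. The factor [s ^+ k <= 1] is then dropped. *)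
have Dxu : `|Dk x f| <= `|Dk u f| + eps / 4.
  apply: (@le_trans _ _ (`|Dk (fun i => s *: u i) f| + C * t)).
    apply: Dk_dist_le => //; first exact: ltW.
    - by move=> i; rewrite x1.
    - by move=> i; rewrite normrZ gtr0_norm// -ler_pdivlMl// mulr1.
    - move=> i; rewrite -[X in X - _]scale1r scalerA -scalerBl normrZ x1 mulr1.
      have sg : s / g (x i) <= 1 by rewrite ler_pdivrMr// mul1r.
      have sg' : s <= s / g (x i) by rewrite ler_pdivlMr// ler_piMr// ltW.
      by rewrite ger0_norm ?subr_ge0//; move: sg'; rewrite {1}/s; lra.
  apply: lerD => //.
  have -> : (fun i => s *: u i) = (fun i => 0 + s *: u i).
    by apply/funext => i; rewrite add0r.
  rewrite Dk_affine normrM normrX ler_piMl// exprn_ile1//.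
  by rewrite gtr0_norm// /s; lra.
(* This would give [eps <= |Dk x f| <= eps / 2]. *)
suff Du : `|Dk u f| <= eps / 4 by move: Dx Dxu Du eps0; lra.
have [->|Du0] := eqVneq (Dk u f) 0; first by rewrite normr0 divr_ge0 ?ltW.
have [A [MA Au gA AZ]] := hMM g e u f gn e1 ge gu fS Du0.
have A0 : A !=set0 by exists (u ord0 - u ord0).
pose d := dist_set (u ord0) A.
have d1 : 1 <= d.
  apply: le_dist_set => // y Ay.
  by rewrite (le_trans _ (gn _))// linearB /= gu gA// subr0.
have ds : d <= s^-1.
  by rewrite (le_trans (dist_set_le _ (Au ord0)))// subrr subr0.
have dgt0 : 0 < d by apply: lt_le_trans d1.
pose r := alpha / d.
have r0 : 0 < r by rewrite divr_gt0.
have /hd0 : level_set A alpha (r *: u ord0).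
  by rewrite /level_set /= dist_setZ// -/d /r mulfVK// gt_eqF.
(* The points [r *: (u ord0 - u i)] of [A] differ from [r *: u ord0] by [r *: u i], of norm at most
   [alpha / s <= alpha + d0]. *)
move/(_ (fun i => r *: u ord0 + (- r) *: u i) MA) => h.
have {h} : `|Dk (fun i => r *: u ord0 + - r *: u i) f| <= b * (eps / 4).
  apply: h => i; split.
    by rewrite scaleNr -scalerBr; apply: AZ.
  rewrite dist_setZ// -/d /r mulfVK ?gt_eqF//.
  rewrite scaleNr opprB addrC subrK normrZ gtr0_norm//.
  apply: (@le_trans _ _ (alpha * s^-1)).
    apply: ler_pM => //; first exact: ltW.
    by rewrite /r ler_pdivrMr// ler_peMr// ltW.
  rewrite ler_pdivrMr//.
  have : 0 <= d0 * (s - 2^-1) by rewrite mulr_ge0 ?subr_ge0// ltW.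
  by rewrite /s; lra.
rewrite Dk_affine normrM normrX normrN (gtr0_norm r0) => h.
have br : b <= r ^+ k.
  apply: lerXn2r; rewrite ?nnegrE ?(ltW r0) ?divr_ge0 ?(ltW al0)//.
  rewrite /r ler_pM2l// lef_pV2 ?posrE//.
  rewrite (le_trans ds)// -[leRHS]invrK lef_pV2 ?posrE// invr_gt0//.
have : b * `|Dk u f| <= b * (eps / 4).
  by apply: le_trans h; rewrite ler_wpM2r.
by rewrite ler_pM2l.
Qed.

(** * Closed subspaces, kernels and spans of differences *)

Lemma closed_subspaceP A : closed_subspace A <->
  [/\ A 0, forall t x y, A x -> A y -> A (t *: x + y) & closed A].
Proof.
split=> [[[A0 AD] cA]|[A0 AD cA]].
  split=> //; first by rewrite inE in A0.
  by move=> t x y /mem_set Ax /mem_set Ay; have := AD t x y Ax Ay; rewrite inE.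
split=> //; split; first by rewrite inE.
by move=> t x y; rewrite !inE; exact: AD.
Qed.

Lemma closed_subspace_convex A : closed_subspace A -> convex_set A.
Proof.
move=> /closed_subspaceP[A0 AD _] x y l; rewrite !inE => Ax Ay.
by apply: (AD) => //; rewrite -[X in A X]addr0; apply: AD.
Qed.

Lemma continuous_kernel_subspace (g : {linear X -> R^o}) :
  continuous (g : X -> R^o) -> closed_subspace [set x | g x = 0].
Proof.
move=> gc; apply/closed_subspaceP; split=> /= [|t x y gx gy|].
- exact: linear0.
- by rewrite linearP gx gy scaler0 addr0.
- apply: (@preimage_closed _ _ (g : X -> R^o) [set x | x = 0]) => [x _|].
    exact: gc.
  exact: closed_eq.
Qed.

(** [x - g x *: e] is a nearest point: its distance to [x] is [|g x|], and
    [|g x| = |g (x - y)| <= |x - y|] for [y] in the kernel. *)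
Lemma norming_kernel_proximinal (g : {linear X -> R^o}) e :
  (forall x, g x <= `|x|) -> `|e| = 1 -> g e = 1 ->
  proximinal [set x | g x = 0].
Proof.
move=> gn e1 ge x.
have kx : g (x - g x *: e) = 0.
  by rewrite linearB linearZ /= ge -[_ *: _]/(_ * _) mulr1 subrr.
have nx : `|x - (x - g x *: e)| = `|g x|.
  by rewrite opprB addrC subrK normrZ e1 mulr1.
exists (x - g x *: e) => //; apply/le_anti; rewrite dist_set_le// andbT nx.
apply: le_dist_set => [|y /= gy]; first by exists (x - g x *: e).
by rewrite -[g x]subr0 -gy -linearB norming_le.
Qed.

(* When [Dk u f != 0], the barycentric coordinates of [x] along the [u i] are
   read off [f x] by inverting the matrix of [Dk u f]; hence the span of the
   differences is the fixed set of a continuous map, and is closed. *)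
Lemma affine_span_kdim k (u : 'I_k.+1 -> X) (f : 'I_k -> {linear X -> R^o}) :
  (forall j, continuous (f j : X -> R^o)) -> Dk u f != 0 ->
  kdim_subspaces X k
    [set \sum_i v i *: u i | v in [set v : 'I_k.+1 -> R | \sum_i v i = 0]].
Proof.
move=> fc Du0; set F := [set _ | _ in _].
pose M : 'M[R]_(1 + k) := Dmx u f.
have Mu : M \in unitmx by rewrite unitmxE unitfE.
(* The top entry 0 matches the row of ones in [M]: it says that the coefficients sum to zero. *)
pose fv x : 'cV[R]_(1 + k) := col_mx 0 (\col_j f j x).
have Mv (v : 'I_k.+1 -> R) : \sum_i v i = 0 ->
    M *m (\col_i v i) = fv (\sum_i v i *: u i).
  move=> v0; apply/matrixP => i j; rewrite mxE.
  case: (row_cases i) => [->|[i' ->]].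
    rewrite (@col_mxEu R 1 k) mxE -[RHS]v0; apply: eq_bigr => l _.
    by rewrite Dmx_top mul1r mxE.
  rewrite (@col_mxEd R 1 k) mxE.
  have -> : f i' (\sum_l v l *: u l) = \sum_l v l * f i' (u l) :> R.
    by rewrite linear_sum; apply: eq_bigr => l _; exact: linearZ.
  by apply: eq_bigr => l _; rewrite Dmx_bot mxE mulrC.
pose P x := \sum_i (invmx M *m fv x) i 0 *: u i.
have PF x : F (P x).
  exists (fun i => (invmx M *m fv x) i 0) => //=.
  have /matrixP/(_ (lshift k ord0) 0) := mulKVmx Mu (fv x).
  rewrite mxE (@col_mxEu R 1 k) [RHS]mxE => h.
  by rewrite -[RHS]h; apply: eq_bigr => l _; rewrite Dmx_top mul1r.
have FP x : F x -> P x = x.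
  move=> [v /= v0 <-]; rewrite /P -Mv// mulKmx//.
  by apply: eq_bigr => l _; rewrite mxE.
have FE : F = [set x | P x - x = 0].
  apply/seteqP; split=> x /=; first by move/FP ->; rewrite subrr.
  by move/eqP; rewrite subr_eq0 => /eqP <-.
have PE x : P x = \sum_j f j x *: (\sum_i invmx M i (rshift 1 j) *: u i).
  under [RHS]eq_bigr do rewrite scaler_sumr.
  rewrite exchange_big; apply: eq_bigr => i _ /=.
  under [RHS]eq_bigr do rewrite scalerA.
  rewrite -scaler_suml; congr (_ *: _); rewrite mxE big_split_ord /= big_ord1.
  rewrite (@col_mxEu R 1 k) mxE mulr0 add0r; apply: eq_bigr => j _.
  by rewrite (@col_mxEd R 1 k) mxE mulrC.
have Pc : continuous (fun x => P x - x).
  move=> x; apply: cvgB; last exact: cvg_id.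
  rewrite (funext PE).
  pose p j := \sum_i invmx M i (rshift 1 j) *: u i.
  have h := @cvg_big X _ +%R 0 xpredT (@add_continuous X) _ _ _
    (fun j y => f j y *: p j) (fun j => f j x *: p j).
  apply: h => j _. 
  by apply: cvgZr_tmp; exact: fc.
have lift_sum (c : 'I_k -> R) (v : 'I_k.+1 -> R) :
    v ord0 = - \sum_j c j -> (forall j, v (lift ord0 j) = c j) ->
    \sum_i v i *: u i = \sum_j c j *: (u (lift ord0 j) - u ord0).
  move=> v0 vj; rewrite big_ord_recl v0 addrC.
  under [RHS]eq_bigr do rewrite scalerBr.
  rewrite sumrB -scaler_suml scaleNr; congr (_ - _).
  by apply: eq_bigr => j _; rewrite vj.
(* The coefficient at [u ord0] is the one making the total vanish. *)
pose ext (c : 'I_k -> R) i := oapp c (- \sum_j c j) (unlift ord0 i).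
have ext0 c : ext c ord0 = - \sum_j c j by rewrite /ext unlift_none.
have extj c j : ext c (lift ord0 j) = c j by rewrite /ext liftK.
have sum_ext c : \sum_i ext c i = 0.
  rewrite big_ord_recl ext0 addrC; apply/eqP; rewrite subr_eq0; apply/eqP.
  by apply: eq_bigr => j _; rewrite extj.
split.
  apply/closed_subspaceP; split.
  - by exists (fun=> 0); rewrite /= big1// => i _; rewrite scale0r.
  - move=> t _ _ [v /= v0 <-] [w /= w0 <-]; exists (fun i => t * v i + w i) => /=.
      by rewrite big_split /= -mulr_sumr v0 w0 mulr0 addr0.
    rewrite scaler_sumr -big_split; apply: eq_bigr => i _ /=.
    by rewrite scalerDl scalerA.
  - rewrite FE; apply: (@preimage_closed _ _ (fun x => P x - x) [set 0]) => [x _|].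
      exact: Pc.
    exact/accessible_closed_set1/hausdorff_accessible/norm_hausdorff.
exists (fun j => u (lift ord0 j) - u ord0); split.
- move=> c c0 j; have := Mv _ (sum_ext c).
  rewrite (lift_sum c) // c0 => /(congr1 (mulmx (invmx M))).
  rewrite mulKmx// => /matrixP/(_ (lift ord0 j) 0); rewrite mxE extj => ->.
  have -> : fv 0 = 0.
    rewrite /fv (_ : \col_j f j 0 = 0) ?col_mx0//.
    by apply/matrixP => a b; rewrite !mxE linear0.
  by rewrite mulmx0 mxE.
- apply/seteqP; split=> x.
    move=> [v /= v0 <-]; exists (fun j => v (lift ord0 j)) => //.
    rewrite -(lift_sum _ v)//; apply/eqP.
    by rewrite -addr_eq0; move: v0; rewrite big_ord_recl => ->.
  move=> [c _ <-]; exists (ext c) => /=; first exact: sum_ext.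
  by rewrite (lift_sum c).
Qed.

End Rotundity.

(** * The cycle of implications *)

Unset Implicit Arguments.

Theorem theorem3p18 (R : realType) (X : completeNormedModType R) (k : nat)
    (alpha : R) (hk : (0 < k)%N) (halpha : 0 < alpha) :
  [<-> WUR X k;
       equi_wUSCh k (proximinal_convex_sets X) alpha;
       equi_wUSCh k (proximinal_subspaces X) alpha;
       equi_wUSCh k (proximinal_hyperplanes X) alpha;
       equi_wUSCh k (kdim_subspaces X k) alpha].
Proof.
have mono (MM MM' : set (set X)) : (MM' `<=` MM)%classic ->
    equi_wUSCh k MM alpha -> equi_wUSCh k MM' alpha.
  move=> sM h eps f e0 fS; have [d d0 hd] := h eps f e0 fS.
  by exists d => // A x y /sM; exact: hd.
have H_WUR : equi_wUSCh k (proximinal_hyperplanes X) alpha -> WUR X k.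
  apply: equi_WUR => // g e u f gn e1 ge gu _ _.
  exists [set x | g x = 0]%classic; split=> //=.
  - split; last exact: norming_kernel_proximinal gn e1 ge.
    by exists g => //; exact: norming_dual_sphere gn e1 ge.
  - by move=> i; rewrite linearB /= !gu subrr.
  - by move=> t y gy; rewrite linearZ /= gy scaler0.
tfae.
- by apply: WUR_equi => // A [].
- apply: mono => A [sA pA]; split=> //; last exact: closed_subspace_convex.
  by exists 0; case/closed_subspaceP: sA.
- apply: mono => A [[f [fc f1] ->] pA]; split=> //.
  exact: continuous_kernel_subspace.
(* (4) => (5) passes through (1), as the two families are not nested in general. *)
- move/H_WUR; apply: WUR_equi => // A [sA _]; exact: closed_subspace_convex.
- apply: equi_WUR => // g e u f gn e1 ge gu fS Du0.
  exists [set \sum_i v i *: u i | v in [set v : 'I_k.+1 -> R | \sum_i v i = 0]]%classic.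
  split.
  + by apply: affine_span_kdim Du0 => j; case: (fS j).
  (* [u ord0 - u i] has as coefficients the difference of two Kronecker deltas, of total zero. *)
  + have delta i : \sum_j (j == i)%:R *: u j = u i.
      rewrite (bigD1 i)//= eqxx scale1r big1 ?addr0// => j /negbTE ->.
      by rewrite scale0r.
    have delta1 i : \sum_(j < k.+1) (j == i)%:R = 1 :> R.
      by rewrite (bigD1 i)//= eqxx big1 ?addr0// => j /negbTE ->.
    move=> i; exists (fun j => (j == ord0)%:R - (j == i)%:R) => /=.
      by rewrite sumrB !delta1 subrr.
    by under eq_bigr do rewrite scalerBl; rewrite sumrB !delta.
  + move=> _ [v /= v0 <-]; rewrite -[RHS]v0 linear_sum; apply: eq_bigr => i _.
    by rewrite linearZ /= gu; exact: mulr1.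
  + move=> t _ [v /= v0 <-]; exists (fun i => t * v i).
      by rewrite /= -mulr_sumr v0 mulr0.
    by rewrite scaler_sumr; apply: eq_bigr => i _; rewrite scalerA.
Qed.
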